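(* Let $C\ge 1$ and let $\mathcal{S}_1,\dots,\mathcal{S}_C$ be Polish spaces. For each multi-index $\mathbf{N}=(N_i)_{1\le i\le C}\in\mathbb{N}^C$ (with $N_i\ge1$), let $(X^{\mathbf{N}}_{n,i})_{1\le n\le N_i,\,1\le i\le C}$ be a finite multi-exchangeable multi-class system, $X^{\mathbf{N}}_{n,i}$ having state space $\mathcal{S}_i$. Let $P_i\in\mathcal{P}(\mathcal{S}_i)$ for $1\le i\le C$. Then the family of multi-class systems is $(P_1,\dots,P_C)$-chaotic, that is, $$\lim_{\mathbf{N}\to\infty}\mathcal{L}\bigl((X^{\mathbf{N}}_{n,i})_{1\le n\le k,\,1\le i\le C}\bigr)=P_1^{\otimes k}\otimes\cdots\otimes P_C^{\otimes k}\quad\text{for all }k\ge1,$$ if and only if, for each $1\le i\le C$, the $(X^{\mathbf{N}}_{n,i})_{1\le n\le N_i}$ are $P_i$-chaotic, that is, $$\lim_{\mathbf{N}\to\infty}\mathcal{L}(X^{\mathbf{N}}_{1,i},\dots,X^{\mathbf{N}}_{k,i})=P_i^{\otimes k}\quad\text{for all }k\ge1.$$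
   Context: $\lim_{\mathbf{N}\to\infty}$ denotes the limit along a fixed arbitrary subsequence of $\mathbf{N}\in\mathbb{N}^C$ such that $\min_{1\le i\le C}N_i$ goes to infinity (the laws for a given $k$ being defined once $\min_i N_i\ge k$). Limits of laws are for the weak topology. $\mathcal{P}(\mathcal{S})$ is the space of Borel probability measures on $\mathcal{S}$, $\mathcal{L}$ denotes the law of a random element, and for $k\ge1$, $\Sigma(k)$ is the set of permutations of $\{1,\dots,k\}$. A finite multi-class system $(X^{\mathbf{N}}_{n,i})_{1\le n\le N_i,\,1\le i\le C}$ ($X^{\mathbf{N}}_{n,i}$ with values in $\mathcal{S}_i$) is multi-exchangeable if $$\mathcal{L}\bigl((X^{\mathbf{N}}_{\sigma_i(n),i})_{1\le n\le N_i,\,1\le i\le C}\bigr)=\mathcal{L}\bigl((X^{\mathbf{N}}_{n,i})_{1\le n\le N_i,\,1\le i\le C}\bigr)\quad\text{for all }\sigma_i\in\Sigma(N_i),\ 1\le i\le C.$$ *)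

(* Defs.v *)
From HB Require Import structures.
From mathcomp Require Import all_boot all_order all_algebra perm.
From mathcomp Require Import all_classical all_reals all_analysis.

Set Implicit Arguments.
Unset Strict Implicit.
Unset Printing Implicit Defensive.

Import Order.TTheory GRing.Theory Num.Theory.
Import numFieldNormedType.Exports.

Local Open Scope classical_set_scope.
Local Open Scope ring_scope.

Definition separable (T : topologicalType) :=
  exists2 D : set T, countable D & dense D.

Definition is_distance (R : realType) (T : Type) (d : T -> T -> R) :=
  [/\ forall x y, 0 <= d x y,
      forall x y, d x y = 0 <-> x = y,
      forall x y, d x y = d y x &
      forall x y z, d x z <= d x y + d y z].

Definition metrizes (R : realType) (T : topologicalType) (d : T -> T -> R) :=
  forall (x : T) (A : set T),
    nbhs x A <-> exists2 e : R, 0 < e & [set y | d x y < e] `<=` A.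

Definition complete_distance (R : realType) (T : topologicalType)
    (d : T -> T -> R) :=
  forall u : nat -> T,
    (forall e : R, 0 < e -> exists M : nat,
       forall m n, (M <= m)%N -> (M <= n)%N -> d (u m) (u n) < e) ->
    exists l : T, u @ \oo --> l.

HB.mixin Record isPolish (R : realType) T & PointedTopological T := {
  polish_separable : separable T;
  polish_metrizable : exists d : T -> T -> R,
    [/\ is_distance d, metrizes d & complete_distance d]
}.

(* Nonempty (pointed), as is any space carrying a probability measure. *)
#[short(type="polishType")]
HB.structure Definition Polish (R : realType) :=
  {T of PointedTopological T & isPolish R T}.

Definition borel (T : ptopologicalType) : measurableType (@open T).-sigma :=
  g_sigma_algebraType (@open T).

HB.instance Definition _ (I : Type) (S : I -> ptopologicalType) :=
  Pointed.on (prod_topology S).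

Lemma polish_basis (R : realType) (T : polishType R) :
  exists B : nat -> set T, (forall n, open (B n)) /\
    forall x A, nbhs x A -> exists2 n, B n x & B n `<=` A.
Proof.
have [D cD dD] := @polish_separable R T.
have [d [[d0 dxx dC dT] dN _]] := @polish_metrizable R T.
have oball x (e : R) : open [set y | d x y < e].
  rewrite openE => y /= dxy; apply/dN; exists (e - d x y).
    by rewrite subr_gt0.
  by move=> z /= dyz; apply: le_lt_trans (dT x y z) _; rewrite -ltrBrDl.
have [D0|/set0P[x0 Dx0]] := eqVneq D set0.
  have /dD : [set: T] !=set0 by exists point.
  by rewrite D0 => /(_ openT) [? []].
have [g [gD Dg]] : exists g : nat -> T,
    (forall n, D (g n)) /\ forall x, D x -> exists n, g n = x.
  have /countable_injP[f finj] := cD.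
  exists (fun n => xget x0 [set x | D x /\ f x = n]); split => [n|x Dx].
    by case: xgetP => [y _ []|].
  exists (f x); case: xgetP => [y _ [Dy fyx]|/(_ x)].
    by apply: finj; rewrite ?inE.
  by case.
exists (fun n => if unpickle n is Some (a, b)
  then [set y | d (g a) y < b.+1%:R^-1] else set0); split.
  by move=> n; case: unpickle => [[a b]|]; [exact: oball|exact: open0].
move=> x A /dN[e e0 eA].
have [b be] : exists b : nat, b.+1%:R^-1 < e / 2 :> R.
  have e20 : 0 < e / 2 by rewrite divr_gt0.
  have := near_infty_natSinv_lt (PosNum e20) => -[b _ /(_ b)] /= h.
  by exists b; exact: h.
have b0 : 0 < b.+1%:R^-1 :> R by rewrite invr_gt0.
have [||y [/= dxy Dy]] := dD [set y | d x y < b.+1%:R^-1].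
- by exists x => /=; rewrite (dxx x x).2.
- exact: oball.
have [a gay] := Dg _ Dy.
exists (pickle (a, b)); rewrite pickleK /=; first by rewrite gay dC.
move=> z /= dz; apply: eA => /=.
rewrite gay in dz.
apply: le_lt_trans (dT x y z) _; rewrite (splitr e).
by apply: ltrD; exact: lt_trans be.
Qed.

Lemma prod_topology_box (I : finType) (S : I -> topologicalType)
    (x : prod_topology S) (U : set (prod_topology S)) :
  nbhs x U -> exists A : forall i, set (S i),
    (forall i, nbhs (x i) (A i)) /\
    [set y : prod_topology S | forall i, A i (y i)] `<=` U.
Proof.
pose F : set_system (prod_topology S) := filter_from
  [set A : forall i, set (S i) | forall i, nbhs (x i) (A i)]
  (fun A => [set y | forall i, A i (y i)]).
have FF : Filter F.
  apply: filter_from_filter; first by exists (fun=> setT) => i; exact: filterT.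
  move=> A B /= nA nB; exists (fun i => A i `&` B i).
    by move=> i; exact: filterI.
  by move=> y /= yAB; split => i; have [] := yAB i.
have Fx : F --> x.
  apply/cvg_sup => i A; rewrite nbhsE /= => -[B [[C oC CB] Bx] BA].
  exists (fun j => [set z | forall e : j = i, C (ecast j (S j) e z)]).
    move=> j /=; have [ji|ji] := eqVneq j i; last first.
      by near=> z => e; rewrite e eqxx in ji.
    subst j; have : nbhs (x i) C.
      by apply: open_nbhs_nbhs; split => //; rewrite -CB in Bx.
    by apply: filterS => z Cz e; rewrite eq_axiomK.
  by move=> y /= /(_ i erefl) /= Cy; apply: BA; rewrite -CB.
by move=> /Fx [A nA AU]; exists A.
Unshelve. all: by end_near. Qed.

Section finite_products.
Context {R : realType} {I : finType} (S : I -> polishType R).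

(* This is where separability enters: open sets of a finite product are
   countable unions of open boxes. *)
Lemma measurable_fun_prod d (Om : measurableType d)
    (f : Om -> borel (prod_topology S)) :
  (forall i, measurable_fun setT (fun w => f w i : borel (S i))) ->
  measurable_fun setT f.
Proof.
move=> mf; apply: (@measurability _ _ _ (borel (prod_topology S)) _ _ open) => //.
move=> _ [U oU <-]; rewrite setTI.
pose B i := projT1 (cid (polish_basis (S i))).
have HB i : (forall n, open (B i n)) /\
    forall x A, nbhs x A -> exists2 n, B i n x & B i n `<=` A.
  exact: projT2 (cid (polish_basis (S i))).
pose box (b : {ffun I -> nat}) := [set y : prod_topology S |
  forall i, B i (b i) (y i)].
have -> : f @^-1` U = \bigcup_(b in [set b | box b `<=` U]) (f @^-1` box b).
  apply/seteqP; split => [w /= Uw|w [b bU bw]]; last exact: bU.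
  have /prod_topology_box[A [nA AU]] : nbhs (f w : prod_topology S) U.
    exact: open_nbhs_nbhs.
  have /choice[b Hb] : forall i, exists n, B i n (f w i) /\ B i n `<=` A i.
    by move=> i; have [n ? ?] := (HB i).2 _ _ (nA i); exists n.
  exists (finfun b); last by move=> i /=; rewrite ffunE; exact: (Hb i).1.
  move=> y /= yb; apply: AU => i /=; apply: (Hb i).2.
  by have := yb i; rewrite ffunE.
rewrite bigcup_mkcond; apply: countable_bigcupT_measurable.
  exact: countableP.
move=> b; case: ifPn => // _.
have -> : f @^-1` box b = \bigcap_(i in [set: I]) ((fun w => f w i) @^-1` B i (b i)).
  by apply/seteqP; split => w /= h i => [_|]; exact: h.
apply: fin_bigcap_measurable; first exact: finite_finset.
move=> i _; rewrite -[X in measurable X]setTI; apply: mf => //.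
by apply: sub_sigma_algebra; exact: (HB i).1.
Qed.

Lemma measurable_coord (i : I) :
  measurable_fun setT (fun x : borel (prod_topology S) => x i : borel (S i)).
Proof.
apply: (@measurability _ _ _ (borel (S i)) _ _ open) => // _ [U oU <-]; rewrite setTI.
apply: sub_sigma_algebra.
have : continuous (fun x : prod_topology S => x i).
  exact: (@proj_continuous I (fun j => S j) i).
by move=> /continuousP; apply.
Qed.

Section joint_law.
Context d (Om : measurableType d) (Pr : probability Om R).
Variable X : forall i, {RV Pr >-> borel (S i)}.

Definition joint (w : Om) : borel (prod_topology S) := fun i => X i w.

Lemma measurable_joint : measurable_fun setT joint.
Proof. by apply: measurable_fun_prod => i; exact: measurable_funP. Qed.

HB.instance Definition _ := isMeasurableFun.Build _ _ _ _ joint measurable_joint.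

Definition joint_law : probability (borel (prod_topology S)) R :=
  distribution Pr joint.

End joint_law.

Section product_probability.
Variable P : forall i, probability (borel (S i)) R.

Definition update (i : I) (xy : borel (prod_topology S) * borel (S i)) :
  borel (prod_topology S) := dfwith xy.1 i xy.2.

Lemma measurable_update i : measurable_fun setT (@update i).
Proof.
apply: measurable_fun_prod => j; have [<-|ij] := eqVneq i j.
  rewrite (_ : (fun _ => _) = snd); first exact: measurable_snd.
  by apply/funext => xy; rewrite /update dfwithin.
rewrite (_ : (fun _ => _) = (fun x : borel (prod_topology S) => x j) \o fst).
  apply: measurableT_comp; first exact: measurable_coord.
  exact: measurable_fst.
by apply/funext => xy; rewrite /update dfwithout.
Qed.

HB.instance Definition _ i :=
  isMeasurableFun.Build _ _ _ _ (@update i) (@measurable_update i).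

(* Law of a point whose coordinates in [s] are resampled independently
   according to the [P i]. *)
Fixpoint resample (s : seq I) : probability (borel (prod_topology S)) R :=
  if s is i :: s' then distribution (resample s' \x P i)%E (@update i)
  else dirac (point : borel (prod_topology S)).

Definition product_probability := resample (enum I).

Lemma product_probabilityE (A : forall i, set (borel (S i))) :
  (forall i, measurable (A i)) ->
  product_probability [set x | forall i, A i (x i)] =
  (\prod_(i : I) P i (A i))%E.
Proof.
move=> mA.
have step s : uniq s ->
    resample s [set x | forall i, i \in s -> A i (x i)] =
    (\prod_(i <- s) P i (A i))%E.
  elim: s => [_|i s IH /= /andP[ins us]].
    by rewrite big_nil /= diracE mem_set.
  rewrite big_cons -IH// /distribution /pushforward.
  set Z := [set x | forall j, j \in s -> A j (x j)].
  have mZ : measurable (Z : set (borel (prod_topology S))).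
    rewrite (_ : Z = \bigcap_(j in [set` s])
      ((fun x : borel (prod_topology S) => x j) @^-1` A j)).
      apply: fin_bigcap_measurable; first exact: finite_seq.
      move=> j _; rewrite -[X in measurable X]setTI.
      exact: measurable_coord.
    by apply/seteqP; split.
  rewrite (_ : _ @^-1` _ = Z `*` A i).
    rewrite product_measure1E; [by rewrite [RHS]muleC|exact: mZ|exact: mA].
  apply/seteqP; split => -[x y] /=.
    move=> h; split.
      move=> j js; have := h j; rewrite inE js orbT => /(_ isT).
      rewrite /update dfwithout//; apply: contraNneq ins => ->//.
    by have := h i; rewrite mem_head => /(_ isT); rewrite /update dfwithin.
  move=> [Zx Ay] j; rewrite inE => /predU1P[->|js].
    by rewrite /update dfwithin.
  rewrite /update dfwithout; first exact: Zx.
  by apply: contraNneq ins => ->.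
have := step (enum I) (enum_uniq _).
rewrite big_enum /= => <-; congr (resample _ _).
by apply/seteqP; split => x /= h i // ; apply: h; rewrite mem_enum.
Qed.

End product_probability.
End finite_products.

Definition weak_cvg (R : realType) (T : ptopologicalType)
    (mu : nat -> probability (borel T) R) (nu : probability (borel T) R) :=
  forall f : T -> R, continuous f -> bounded_fun f ->
    (\int[mu m]_x f x) @[m --> \oo] --> \int[nu]_x f x.

(* X_(k+1) of the system X_1, ..., X_n (particles are numbered from 0).
   The value for n <= k is a placeholder, met for finitely many indices only
   along a sequence of systems whose sizes tend to infinity. *)
Definition particle (R : realType) (T : ptopologicalType) d
    (Om : measurableType d) (Pr : probability Om R) (n : nat)
    (X : 'I_n -> {RV Pr >-> borel T}) (k : nat) : {RV Pr >-> borel T} :=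
  if insub k is Some j then X j else cst point.

Definition multi_exchangeable (R : realType) (C : nat)
    (S : 'I_C -> polishType R) d (Om : measurableType d)
    (Pr : probability Om R) (N : 'I_C -> nat)
    (X : forall i, 'I_(N i) -> {RV Pr >-> borel (S i)}) :=
  forall sigma : forall i, 'S_(N i),
  forall A, measurable A ->
    joint_law (fun j : {i : 'I_C & 'I_(N i)} =>
      X (tag j) (sigma (tag j) (tagged j))) A =
    joint_law (fun j : {i : 'I_C & 'I_(N i)} => X (tag j) (tagged j)) A.

Definition chaotic (R : realType) (T : polishType R)
    (d : nat -> measure_display) (Om : forall m, measurableType (d m))
    (Pr : forall m, probability (Om m) R) (n : nat -> nat)
    (X : forall m, 'I_(n m) -> {RV (Pr m) >-> borel T})
    (P : probability (borel T) R) :=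
  forall k : nat, (0 < k)%N ->
    weak_cvg (fun m => joint_law (fun j : 'I_k => particle (@X m) j))
      (product_probability (fun _ : 'I_k => P)).

Definition multi_chaotic (R : realType) (C : nat) (S : 'I_C -> polishType R)
    (d : nat -> measure_display) (Om : forall m, measurableType (d m))
    (Pr : forall m, probability (Om m) R) (N : nat -> 'I_C -> nat)
    (X : forall m i, 'I_(N m i) -> {RV (Pr m) >-> borel (S i)})
    (P : forall i, probability (borel (S i)) R) :=
  forall k : nat, (0 < k)%N ->
    weak_cvg
      (fun m => joint_law (fun j : 'I_C * 'I_k => particle (@X m j.1) j.2))
      (product_probability (fun j : 'I_C * 'I_k => P j.1)).

(* Main.v *)
Require Import Defs.
From mathcomp Require Import all_boot all_order all_algebra perm.
From mathcomp Require Import all_classical all_reals all_analysis.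
From mathcomp Require Import measurable_realfun.
From mathcomp Require Import ring lra zify.

Set Implicit Arguments.
Unset Strict Implicit.
Unset Printing Implicit Defensive.

Import Order.TTheory GRing.Theory Num.Theory.
Import numFieldNormedType.Exports.

Local Open Scope classical_set_scope.
Local Open Scope ring_scope.

(** The direct implication is a marginalisation: the law of the first [k]
particles of class [i] is the image of the joint law under a coordinate
projection, and likewise for the product measures.

For the converse, weak convergence on a finite product of Polish spaces is first
reduced to convergence of the integrals of tensors [x |-> \prod_i g i (x i)],
with each [g i] continuous and valued in [0, 1] ([weak_cvg_tensor]). Indeed a
Polish space has countably many continuous bumps whose positivity sets form a
base, so the indicator of an open set [U] of the product is the limit of the
functions [1 - \prod_(l < n) (1 - G l) ^+ n], the [G l] being the tensors of
bumps supported in [U]. Expanding the product, these are combinations of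
tensors, and they lie below [\1_U]. Hence the integrals of continuous functions
are lower semicontinuous along the sequence of laws, and applying this to [f]
and [1 - f] gives convergence.

It remains to compute the limit of the expectation of
[\prod_i \prod_(j < k) g i j (X j i)]. Exchangeability within each class,
separately, allows the first [k] particles of class [i] to be replaced by the
[b i]-th block of [k] consecutive particles without changing this expectation,
for any choice of blocks ([expect_blocks]). Averaging over all choices with
[b i < M], the expectation equals that of [\prod_i V i], where [V i] is the
average over [M] blocks of class [i] of the block products
([expect_block_averages]). Chaoticity of class [i] alone, used for [M * k]
particles, says that [V i] is asymptotically distributed as an average of [M]
independent variables with mean [c i = \prod_j \int[P i]_y g i j y], so the
expectation of [(V i - c i) ^+ 2] is asymptotically at most [M%:R^-1]
([variance_block_average]): with many blocks the [V i] are nearly deterministic,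
and the expectation of [\prod_i V i] is close to [\prod_i c i] whatever the
dependence between classes. As [M] is arbitrary, the limit is [\prod_i c i], the
integral of the tensor against the product measure. *)

(** * Bounded measurable functions *)

Section bounded_measurable.
Context d (T : measurableType d) (R : realType).
Implicit Types f g : T -> R.

Definition bmeas f := measurable_fun setT f /\ exists B, forall x, `|f x| <= B.

Lemma bmeas_cst r : bmeas (fun=> r).
Proof. by split; [exact: measurable_cst|exists `|r|]. Qed.

Lemma bmeasD f g : bmeas f -> bmeas g -> bmeas (fun x => f x + g x).
Proof.
move=> [mf [B fB]] [mg [D gD]]; split; first exact: measurable_funD.
by exists (B + D) => x; apply: le_trans (ler_normD _ _) (lerD _ _).
Qed.

Lemma bmeasM f g : bmeas f -> bmeas g -> bmeas (fun x => f x * g x).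
Proof.
move=> [mf [B fB]] [mg [D gD]]; split; first exact: measurable_funM.
by exists (B * D) => x; rewrite normrM ler_pM.
Qed.

Lemma bmeasB f g : bmeas f -> bmeas g -> bmeas (fun x => f x - g x).
Proof.
move=> bf bg; rewrite (_ : (fun _ => _) = fun x => f x + (- 1) * g x).
  by apply: bmeasD => //; apply: bmeasM => //; exact: bmeas_cst.
by apply/funext => x; rewrite mulN1r.
Qed.

Lemma bmeas_sum (J : Type) (s : seq J) (Q : pred J) (f : J -> T -> R) :
  (forall j, bmeas (f j)) -> bmeas (fun x => \sum_(j <- s | Q j) f j x).
Proof.
move=> bf; elim: s => [|j s IH].
  by under eq_fun do rewrite big_nil; exact: bmeas_cst.
under eq_fun do rewrite big_cons.
by case: (Q j) => //; exact: bmeasD.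
Qed.

Lemma bmeas_prod (J : Type) (s : seq J) (Q : pred J) (f : J -> T -> R) :
  (forall j, bmeas (f j)) -> bmeas (fun x => \prod_(j <- s | Q j) f j x).
Proof.
move=> bf; elim: s => [|j s IH].
  by under eq_fun do rewrite big_nil; exact: bmeas_cst.
under eq_fun do rewrite big_cons.
by case: (Q j) => //; exact: bmeasM.
Qed.

Lemma bmeas_indic (A : set T) : measurable A -> bmeas (\1_A : T -> R).
Proof.
move=> mA; split; first exact: measurable_indic.
by exists 1 => x; rewrite indicE ger0_norm ?lern1 ?leq_b1.
Qed.

Variable mu : probability T R.

Lemma bmeas_integrable f : bmeas f -> mu.-integrable setT (EFin \o f).
Proof.
move=> [mf [B fB]]; apply: measurable_bounded_integrable => //.
- by rewrite (le_lt_trans (probability_le1 _ _)) ?ltry.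
- exists B; split; first by rewrite num_real.
  by move=> x Bx y _; exact: le_trans (fB y) (ltW Bx).
Qed.

Lemma expect_cst r : \int[mu]_x r = r.
Proof.
rewrite Rintegral_cst// (_ : fine _ = 1) ?mulr1//.
exact: (congr1 fine (probability_setT mu)).
Qed.

Lemma expectD f g : bmeas f -> bmeas g ->
  \int[mu]_x (f x + g x) = \int[mu]_x f x + \int[mu]_x g x.
Proof. by move=> bf bg; rewrite RintegralD//; exact: bmeas_integrable. Qed.

Lemma expectB f g : bmeas f -> bmeas g ->
  \int[mu]_x (f x - g x) = \int[mu]_x f x - \int[mu]_x g x.
Proof. by move=> bf bg; rewrite RintegralB//; exact: bmeas_integrable. Qed.

Lemma expectZ r f : bmeas f -> \int[mu]_x (r * f x) = r * \int[mu]_x f x.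
Proof. by move=> bf; rewrite RintegralZl//; exact: bmeas_integrable. Qed.

Lemma expect_sum (J : Type) (s : seq J) (Q : pred J) (f : J -> T -> R) :
  (forall j, bmeas (f j)) ->
  \int[mu]_x (\sum_(j <- s | Q j) f j x) = \sum_(j <- s | Q j) \int[mu]_x f j x.
Proof.
move=> bf; elim: s => [|j s IH].
  rewrite big_nil; under eq_Rintegral do rewrite big_nil.
  exact: expect_cst.
rewrite big_cons -IH; under eq_Rintegral do rewrite big_cons.
by case: (Q j) => //; rewrite expectD//; exact: bmeas_sum.
Qed.

Lemma le_expect f g : bmeas f -> bmeas g -> (forall x, f x <= g x) ->
  \int[mu]_x f x <= \int[mu]_x g x.
Proof. by move=> bf bg fg; apply: le_Rintegral => //; exact: bmeas_integrable. Qed.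

Lemma expect_unit f : bmeas f -> (forall x, 0 <= f x <= 1) ->
  0 <= \int[mu]_x f x <= 1.
Proof.
move=> bf f01; apply/andP; split.
  by apply: Rintegral_ge0 => x _; case/andP: (f01 x).
rewrite -[leRHS]expect_cst; apply: le_expect => //; first exact: bmeas_cst.
by move=> x; case/andP: (f01 x).
Qed.

Lemma expect_EFin f : bmeas f ->
  (\int[mu]_x (f x)%:E)%E = (\int[mu]_x f x)%:E.
Proof.
move=> bf; rewrite /Rintegral fineK//.
by apply: integrable_fin_num => //; exact: bmeas_integrable.
Qed.

Lemma expect_bounded_cvg (f_ : nat -> T -> R) f (B : R) :
  (forall n, bmeas (f_ n)) -> (forall n x, `|f_ n x| <= B) -> bmeas f ->
  (forall x, f_ n x @[n --> \oo] --> f x) ->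
  \int[mu]_x f_ n x @[n --> \oo] --> \int[mu]_x f x.
Proof.
move=> bf_ fB bf f_f.
have : (\int[mu]_x (f_ n x)%:E)%E @[n --> \oo] --> (\int[mu]_x (f x)%:E)%E.
  apply: (@dominated_cvg _ _ _ mu setT measurableT
    (fun n x => (f_ n x)%:E) (EFin \o f) (cst B%:E)) => //=.
  - by move=> n; apply/measurable_EFinP; exact: (bf_ n).1.
  - by move=> x _; apply/fine_cvgP; split; [exact: nearW|exact: f_f].
  - by have := bmeas_integrable (bmeas_cst B).
  - by move=> n x _; rewrite lee_fin.
rewrite (expect_EFin bf) => /fine_cvgP[_]; apply: cvg_trans.
by apply: near_eq_cvg; apply: nearW => n /=.
Qed.

End bounded_measurable.

Lemma bmeas_comp d d' (T : measurableType d) (T' : measurableType d')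
    (R : realType) (f : T' -> R) (h : T -> T') :
  measurable_fun setT h -> bmeas f -> bmeas (f \o h).
Proof.
move=> mh [mf [B fB]]; split; first exact: measurableT_comp.
by exists B => x; exact: fB.
Qed.

Lemma expect_distribution d d' (T : measurableType d) (T' : measurableType d')
    (R : realType) (Pr : probability T R) (Y : {RV Pr >-> T'}) (f : T' -> R) :
  bmeas f -> \int[distribution Pr Y]_y f y = \int[Pr]_w f (Y w).
Proof.
move=> bf; rewrite /Rintegral integral_distribution//.
- by apply/measurable_EFinP; exact: bf.1.
- apply: (@bmeas_integrable _ _ _ _ (f \o Y)).
  by apply: bmeas_comp => //; exact: measurable_funP.
Qed.

(** * Continuous functions with values in the unit interval *)

Section continuous_functions.
Context {R : realType}.

Lemma continuous_bmeas (T : ptopologicalType) (f : T -> R) B :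
  continuous f -> (forall x, `|f x| <= B) -> bmeas (f : borel T -> R).
Proof.
move=> /continuousP cf fB; split; last by exists B.
apply: (measurability _ (RGenOpens.measurableE R)).
move=> _ [_ [a [b ->] <-]]; rewrite setTI.
by apply: sub_sigma_algebra; apply: cf; exact: interval_open.
Qed.

Definition unit_test (T : topologicalType) (f : T -> R) :=
  continuous f /\ forall x, 0 <= f x <= 1.

Lemma unit_test_bmeas (T : ptopologicalType) (f : T -> R) :
  unit_test f -> bmeas (f : borel T -> R).
Proof.
move=> [cf f01]; apply: (continuous_bmeas (B := 1)) => // x.
by have /andP[? ?] := f01 x; rewrite ger0_norm.
Qed.

Lemma unit_test_cst (T : topologicalType) (r : R) :
  0 <= r <= 1 -> unit_test (fun _ : T => r).
Proof. by move=> r01; split=> // x; exact: cvg_cst. Qed.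

Lemma unit_testM (T : topologicalType) (f g : T -> R) :
  unit_test f -> unit_test g -> unit_test (fun x => f x * g x).
Proof.
move=> [cf f01] [cg g01]; split=> x.
  by apply: cvgM; [exact: cf|exact: cg].
have /andP[? ?] := f01 x; have /andP[? ?] := g01 x.
by rewrite mulr_ge0// mulr_ile1.
Qed.

Lemma unit_test_onem (T : topologicalType) (f : T -> R) :
  unit_test f -> unit_test (fun x => 1 - f x).
Proof.
move=> [cf f01]; split=> x; last by have := f01 x; lra.
by apply: cvgB; [exact: cvg_cst|exact: cf].
Qed.

Lemma unit_test_rescale (T : topologicalType) (f : T -> R) (B : R) :
  continuous f -> 0 < B -> (forall x, `|f x| <= B) ->
  unit_test (fun x => (2 * B)^-1 * (f x + B)).
Proof.
move=> cf B0 fB; split=> x.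
  apply: cvgM; first exact: cvg_cst.
  by apply: cvgD; [exact: cf|exact: cvg_cst].
have := fB x; rewrite ler_norml => /andP[lo up].
rewrite mulr_ge0 ?invr_ge0 ?mulr_ge0 ?(ltW B0)//=; last by lra.
by rewrite ler_pdivrMl ?mulr_gt0//; lra.
Qed.

Lemma unit_test_mean (T : topologicalType) (M : nat) (f : 'I_M -> T -> R) :
  (0 < M)%N -> (forall b, unit_test (f b)) ->
  unit_test (fun x => M%:R^-1 * \sum_b f b x).
Proof.
move=> M_gt0 tf; have M0 : 0 < M%:R :> R by rewrite ltr0n.
split=> x.
  apply: cvgM; first exact: cvg_cst.
  by apply: (@cvg_big _ _ _ _ _ add_continuous) => b _; exact: (tf b).1.
have f01 b : 0 <= f b x <= 1 by exact: (tf b).2.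
rewrite mulr_ge0 ?invr_ge0 ?(ltW M0)//=; last first.
  by apply: sumr_ge0 => b _; case/andP: (f01 b).
rewrite ler_pdivrMl// mulr1 -[X in _ <= X%:R]card_ord -sumr_const.
by apply: ler_sum => b _; case/andP: (f01 b).
Qed.

Lemma unit_test_sqr_dist (T : topologicalType) (f : T -> R) (c : R) :
  0 <= c <= 1 -> unit_test f -> unit_test (fun x => (f x - c) ^+ 2).
Proof.
move=> c01 [cf f01]; split=> x; last first.
  move: (f01 x) c01; set y := f x => /andP[y0 y1] /andP[c0 c1].
  rewrite sqr_ge0/= -subr_ge0 (_ : _ - _ = (1 - (y - c)) * (1 + (y - c))).
    by rewrite mulr_ge0//; lra.
  by ring.
apply: (@continuous_comp _ _ _ (fun y => f y - c) (fun r : R => r ^+ 2)).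
  by apply: cvgB; [exact: cf|exact: cvg_cst].
exact: exprn_continuous.
Qed.

Lemma unit_test_comp (T T' : topologicalType) (f : T' -> R) (h : T -> T') :
  unit_test f -> continuous h -> unit_test (f \o h).
Proof.
move=> [cf f01] ch; split=> x; last exact: f01.
by apply: continuous_comp; [exact: ch|exact: cf].
Qed.

Lemma unit_test_prod (T : topologicalType) (J : Type) (s : seq J) (Q : pred J)
    (f : J -> T -> R) :
  (forall j, Q j -> unit_test (f j)) -> unit_test (fun x => \prod_(j <- s | Q j) f j x).
Proof.
move=> tf; elim: s => [|j s IH].
  by under eq_fun do rewrite big_nil; apply: unit_test_cst; rewrite ler01 lexx.
under eq_fun do rewrite big_cons.
by case: (boolP (Q j)) => // Qj; apply: unit_testM => //; exact: tf.
Qed.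

(** The bumps are [y |-> max 0 (1 - (b + 1) * d p y)], with [p] in a countable dense
set; their positivity sets are the balls of radius [1 / (b + 1)] about [p]. *)
Lemma unit_bumps (T : polishType R) :
  exists phi : nat -> T -> R, (forall n, unit_test (phi n)) /\
    forall x A, nbhs x A ->
      exists n, 0 < phi n x /\ forall y, 0 < phi n y -> A y.
Proof.
have [B [oB HB]] := polish_basis T.
have [d [[d0 dxx dC dT] dN _]] := @polish_metrizable R T.
(* One point in each nonempty basic open set: a countable dense family. *)
pose p n := xget point (B n).
pose phi n y : R := if unpickle n is Some (a, b)
  then Num.max 0 (1 - b.+1%:R * d (p a) y) else 0.
have cd a : continuous (d a).
  move=> y; apply/cvgrPdist_lt => e e0; near=> z.
  have dyz : d y z < e.
    by near: z; apply/dN; exists e.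
  rewrite ltr_norml; apply/andP; split.
    by have := dT a y z; lra.
  by have := dT a z y; rewrite (dC z y); lra.
exists phi; split.
  move=> n; rewrite /phi; case: unpickle => [[a b]|]; last first.
    by apply: unit_test_cst; rewrite lexx ler01.
  split=> [|x].
    move=> x; apply: (@continuous_comp _ _ _ (fun y : T => 1 - b.+1%:R * d (p a) y)
      (fun r : R => Num.max 0 r)).
      by apply: cvgB; [exact: cvg_cst|apply: cvgM; [exact: cvg_cst|exact: cd]].
    by apply: continuous_max => //; exact: cvg_cst.
  rewrite le_max lexx/= ge_max ler01/= gerBl.
  by rewrite mulr_ge0.
move=> x A /dN[e e0 eA].
have [b be] : exists b : nat, b.+1%:R^-1 < e / 2 :> R.
  have e20 : 0 < e / 2 by rewrite divr_gt0.
  have := near_infty_natSinv_lt (PosNum e20) => -[b _ /(_ b)] /= h.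
  by exists b; exact: h.
have b0 : 0 < b.+1%:R :> R by [].
have [|n Bnx Bn] := HB x [set y | d x y < b.+1%:R^-1].
  by apply/dN; exists b.+1%:R^-1 => //; rewrite invr_gt0.
have dxp : d x (p n) < b.+1%:R^-1.
  by apply: Bn; rewrite /p; case: xgetP => // /(_ x).
have phiE y : (0 < phi (pickle (n, b)) y) = (d (p n) y < b.+1%:R^-1).
  rewrite /phi pickleK lt_max ltxx/= subr_gt0 -ltr_pdivlMl//.
  by rewrite mulr1.
exists (pickle (n, b)); rewrite phiE dC; split => // y; rewrite phiE => dpy.
apply: eA => /=; apply: le_lt_trans (dT x (p n) y) _.
by rewrite (splitr e) ltrD// (lt_trans _ be).
Unshelve. all: by end_near. Qed.

End continuous_functions.

(** * Tensors on a finite product of Polish spaces *)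

Section tensor_products.
Context {R : realType} {I : finType} (S : I -> polishType R).

Definition tensor (g : forall i, S i -> R) (x : prod_topology S) : R :=
  \prod_i g i (x i).

Lemma unit_test_coord (i : I) (g : S i -> R) :
  unit_test g -> unit_test (fun x : prod_topology S => g (x i)).
Proof.
move=> tg; apply: (unit_test_comp (h := fun x : prod_topology S => x i) tg).
exact: (@proj_continuous I (fun j => S j) i).
Qed.

Lemma unit_test_tensor (g : forall i, S i -> R) :
  (forall i, unit_test (g i)) -> unit_test (tensor g).
Proof.
by move=> tg; apply: unit_test_prod => i _; apply: unit_test_coord; exact: tg.
Qed.

(** Fubini's theorem along the recursive construction of the product measure: each
resampling step contributes one factor. *)
Lemma expect_tensor (P : forall i, probability (borel (S i)) R)
    (g : forall i, S i -> R) : (forall i, unit_test (g i)) ->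
  \int[product_probability P]_x tensor g x = \prod_i \int[P i]_y g i y.
Proof.
move=> tg.
have bs s : bmeas (fun x : borel (prod_topology S) => \prod_(i <- s) g i (x i)).
  apply: unit_test_bmeas; apply: unit_test_prod => i _.
  by apply: unit_test_coord; exact: tg.
have step s : uniq s ->
    \int[resample P s]_x (\prod_(i <- s) g i (x i)) =
    \prod_(i <- s) \int[P i]_y g i y.
  elim: s => [_|i s IH /= /andP[ins us]].
    rewrite big_nil; under eq_Rintegral do rewrite big_nil.
    exact: (expect_cst (dirac (point : borel (prod_topology S)))).
  rewrite big_cons -IH// expect_distribution; last exact: bs.
  set h := fun x : borel (prod_topology S) => \prod_(j <- s) g j (x j).
  pose F (z : borel (prod_topology S) * borel (S i)) := h z.1 * g i z.2.
  have FE z : \prod_(j <- i :: s) g j (update z j) = F z.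
    rewrite big_cons mulrC /F /h; congr (_ * _); last by rewrite /update dfwithin.
    rewrite big_seq [RHS]big_seq; apply: eq_bigr => j js.
    by rewrite /update dfwithout//; apply: contraNneq ins => ->.
  have bF : bmeas F.
    apply: bmeasM.
      by apply: (bmeas_comp (f := h)); [exact: measurable_fst|exact: bs].
    apply: (bmeas_comp (f := g i : borel (S i) -> R)).
      exact: measurable_snd.
    by apply: unit_test_bmeas; exact: tg.
  have h0 x : 0 <= h x.
    by apply: prodr_ge0 => j _; case/andP: ((tg j).2 (x j)).
  have g0 y : 0 <= g i y by case/andP: ((tg i).2 y).
  under eq_Rintegral do rewrite FE.
  rewrite {1}/Rintegral fubini_tonelli1; last 2 first.
  - by apply/measurable_EFinP; exact: bF.1.
  - by move=> z; rewrite lee_fin mulr_ge0.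
  rewrite /fubini_F /=.
  have bg : bmeas (g i : borel (S i) -> R) by apply: unit_test_bmeas; exact: tg.
  under eq_integral => x _.
    rewrite (expect_EFin (P i) (f := fun y => h x * g i y)); last first.
      by apply: bmeasM => //; exact: bmeas_cst.
    rewrite (expectZ _ _ bg) mulrC.
    over.
  rewrite (expect_EFin (resample P s) (f := fun x => (\int[P i]_y g i y) * h x)).
    by rewrite /= expectZ//; exact: bs.
  by apply: bmeasM; [exact: bmeas_cst|exact: bs].
rewrite -[RHS]big_enum -step ?enum_uniq//.
by apply: eq_Rintegral => x _; rewrite /tensor big_enum.
Qed.

Lemma tensor_bumps : exists G : nat -> forall i, S i -> R,
  (forall n i, unit_test (G n i)) /\
  forall (x : prod_topology S) A, nbhs x A ->
    exists n, 0 < tensor (G n) x /\ forall y, 0 < tensor (G n) y -> A y.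
Proof.
pose phi i := projT1 (cid (unit_bumps (S i))).
have phiP i : (forall n, unit_test (phi i n)) /\
    forall x A, nbhs x A ->
      exists n, 0 < phi i n x /\ forall y, 0 < phi i n y -> A y.
  exact: projT2 (cid (unit_bumps (S i))).
pose G n i := if unpickle n is Some b then phi i ((b : {ffun I -> nat}) i)
  else fun=> 0.
exists G; split.
  move=> n i; rewrite /G; case: unpickle => [b|]; first exact: (phiP i).1.
  by apply: unit_test_cst; rewrite lexx ler01.
move=> x U /prod_topology_box[A [nA AU]].
have /choice[b Hb] : forall i, exists n, 0 < phi i n (x i) /\
    forall y, 0 < phi i n y -> A i y.
  by move=> i; exact: (phiP i).2 (nA i).
exists (pickle (finfun b)).
have GE y : tensor (G (pickle (finfun b))) y = \prod_i phi i (b i) (y i).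
  by apply: eq_bigr => i _; rewrite /G pickleK ffunE.
split; first by rewrite GE; apply: prodr_gt0 => i _; exact: (Hb i).1.
move=> y; rewrite GE => y0; apply: AU => i /=; apply: (Hb i).2.
rewrite lt_neqAle; have /andP[-> _] := ((phiP i).1 (b i)).2 (y i).
rewrite andbT eq_sym; apply: contraTneq y0 => e.
by rewrite (bigD1 i)//= e mul0r ltxx.
Qed.

(** Let the [G l] be the tensors of bumps; [s n] lists, [n] times each, the [l < n]
for which [G l] is supported in [U]. Off [U] every factor is 1; on [U] some
[G l] is positive and its factor, raised to the power [n], tends to 0. *)
Lemma open_approximation (U : set (prod_topology S)) : open U ->
  exists (G : nat -> forall i, S i -> R) (s : nat -> seq nat),
  [/\ forall l i, unit_test (G l i),
      forall n x, ~ U x -> \prod_(l <- s n) (1 - tensor (G l) x) = 1 &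
      forall x, 1 - \prod_(l <- s n) (1 - tensor (G l) x) @[n --> \oo]
        --> (\1_U x : R)].
Proof.
have [G [tG HG]] := tensor_bumps => oU.
pose W l := `[< forall y, 0 < tensor (G l) y -> U y >].
pose s n := flatten [seq nseq n l | l <- iota 0 n & W l].
have G01 l x : 0 <= tensor (G l) x <= 1 by have [_] := unit_test_tensor (tG l).
have sE n x : \prod_(l <- s n) (1 - tensor (G l) x) =
    \prod_(l <- iota 0 n | W l) (1 - tensor (G l) x) ^+ n.
  rewrite /s big_flatten /= big_map big_filter; apply: eq_bigr => l _.
  by elim: n => [|n IH]; rewrite ?big_nil ?expr0// big_cons IH exprS.
have out n x : ~ U x -> \prod_(l <- s n) (1 - tensor (G l) x) = 1.
  move=> Ux; rewrite sE big1// => l /asboolP Wl.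
  suff -> : tensor (G l) x = 0 by rewrite subr0 expr1n.
  apply/eqP; have /andP[t0 _] := G01 l x; rewrite eq_le t0 andbT leNgt.
  by apply/negP => /Wl.
exists G, s; split=> //.
move=> x; rewrite indicE; have [/set_mem Ux|/negP xU] := boolP (x \in U); last first.
    rewrite (_ : (fun _ => _) = cst 0); first exact: cvg_cst.
    apply/funext => n; rewrite out ?subrr// => Ux; apply: xU; exact/mem_set.
  have [|l [tl Wl]] := HG x U; first exact: open_nbhs_nbhs.
  rewrite -[X in _ --> X]subr0; apply: cvgB; first exact: cvg_cst.
  pose q := 1 - tensor (G l) x.
  have q01 : 0 <= q < 1 by have := G01 l x; rewrite /q; lra.
  have /andP[q0 q1] := q01.
  apply: (@squeeze_cvgr _ _ _ _ (cst 0) (fun n => q ^+ n)); last 2 first.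
  - exact: cvg_cst.
  - by apply: cvg_expr; rewrite ger0_norm.
  near=> n; rewrite sE.
  have f01 j : 0 <= (1 - tensor (G j) x) ^+ n <= 1.
    have := G01 j x => /andP[t0 t1].
    by rewrite exprn_ge0 ?subr_ge0// exprn_ile1// ?subr_ge0// gerBl.
  rewrite prodr_ge0/=; last by move=> j _; case/andP: (f01 j).
  rewrite (big_rem l)/=; last first.
    by rewrite mem_iota add0n/=; near: n; exact: nbhs_infty_gt.
  rewrite ifT; last exact/asboolP.
  rewrite ler_piMr ?exprn_ge0//.
  elim: (rem _ _) => [|j r IH]; first by rewrite big_nil.
  rewrite big_cons; case: ifP => // _.
  have /andP[? ?] := f01 j.
  by rewrite mulr_ile1// prodr_ge0// => i _; case/andP: (f01 i).
Unshelve. all: by end_near. Qed.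

End tensor_products.

(** * Convergence of tensors implies weak convergence *)

(** The layer-cake formula: applied to [p * f x], it approximates [f] up to [1 / p]
by the average of the indicators of the open sets where [f] exceeds a multiple
of [1 / p]. *)
Lemma threshold_count (R : realType) (p : nat) (s : R) : 0 <= s <= p%:R ->
  s - 1 <= \sum_(l < p) (l.+1%:R < s)%R%:R <= s.
Proof.
move=> /andP[s0 sp].
suff /(_ p) : forall n, Num.min n%:R (s - 1) <= \sum_(l < n) (l.+1%:R < s)%R%:R
    <= Num.min n%:R s.
  by move=> /andP[lo up]; rewrite (le_trans _ lo) ?(le_trans up)//;
    rewrite ?ge_min ?le_min ?lexx ?orbT// andbT; lra.
elim=> [|n]; first by rewrite big_ord0 le_min ge_min lexx.
rewrite big_ord_recr/= !ge_min !le_min -natr1 => /andP[lo up].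
have [ns|ns] := ltP (n%:R + 1) s.
  move: lo up; rewrite mulr1n.
  by case/orP => lo /andP[up1 up2]; apply/andP; split; [apply/orP; left|apply/andP; split
    |apply/orP; right|apply/andP; split]; lra.
move: lo up; rewrite mulr0n addr0.
by case/orP => lo /andP[up1 up2]; apply/andP; split; [apply/orP; right|apply/andP; split
    |apply/orP; right|apply/andP; split]; lra.
Qed.

Section convergence_criterion.
Context {R : realType} {I : finType} (S : I -> polishType R).
Variables (mu : nat -> probability (borel (prod_topology S)) R)
  (nu : probability (borel (prod_topology S)) R).
Hypothesis cvg_tensor : forall g : forall i, S i -> R,
  (forall i, unit_test (g i)) ->
  \int[mu m]_x tensor g x @[m --> \oo] --> \int[nu]_x tensor g x.

Lemma tensor_bmeas (g : forall i, S i -> R) : (forall i, unit_test (g i)) ->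
  bmeas (tensor g : borel (prod_topology S) -> R).
Proof. by move=> tg; apply: unit_test_bmeas; exact: unit_test_tensor. Qed.

Lemma onem_tensors_bmeas (G : nat -> forall i, S i -> R) (s : seq nat) :
  (forall l i, unit_test (G l i)) ->
  bmeas (fun x : borel (prod_topology S) => \prod_(l <- s) (1 - tensor (G l) x)).
Proof.
move=> tG; apply: bmeas_prod => l; apply: bmeasB; first exact: bmeas_cst.
exact: tensor_bmeas.
Qed.

(** Multiplying by an arbitrary tensor makes the induction on [s] go through, since
a product of two tensors is a tensor. *)
Lemma cvg_onem_tensors (G : nat -> forall i, S i -> R) (s : seq nat) :
  (forall l i, unit_test (G l i)) ->
  \int[mu m]_x (\prod_(l <- s) (1 - tensor (G l) x)) @[m --> \oo] -->
  \int[nu]_x (\prod_(l <- s) (1 - tensor (G l) x)).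
Proof.
move=> tG.
suff H g : (forall i, unit_test (g i)) ->
    \int[mu m]_x (tensor g x * \prod_(l <- s) (1 - tensor (G l) x)) @[m --> \oo]
    --> \int[nu]_x (tensor g x * \prod_(l <- s) (1 - tensor (G l) x)).
  have t1 x : tensor (fun i => cst 1 : S i -> R) x = 1 by apply: big1.
  have E (rho : probability (borel (prod_topology S)) R) :
      \int[rho]_x (\prod_(l <- s) (1 - tensor (G l) x)) =
      \int[rho]_x (tensor (fun i => cst 1 : S i -> R) x *
        \prod_(l <- s) (1 - tensor (G l) x)).
    by apply: eq_Rintegral => x _; rewrite t1 mul1r.
  rewrite E; under eq_fun do rewrite E.
  by apply: H => i; apply: unit_test_cst; rewrite ler01 lexx.
elim: s g => [|l s IH] g tg.
  have E (rho : probability (borel (prod_topology S)) R) :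
      \int[rho]_x (tensor g x * \prod_(j <- [::]) (1 - tensor (G j) x)) =
      \int[rho]_x tensor g x.
    by apply: eq_Rintegral => x _; rewrite big_nil mulr1.
  by rewrite E; under eq_fun do rewrite E; exact: cvg_tensor.
pose gl i x := g i x * G l i x.
have tgl i : unit_test (gl i) by exact: unit_testM.
have E (rho : probability (borel (prod_topology S)) R) :
    \int[rho]_x (tensor g x * \prod_(j <- l :: s) (1 - tensor (G j) x)) =
    \int[rho]_x (tensor g x * \prod_(j <- s) (1 - tensor (G j) x)) -
    \int[rho]_x (tensor gl x * \prod_(j <- s) (1 - tensor (G j) x)).
  rewrite -expectB; last 2 first.
  - by apply: bmeasM; [exact: tensor_bmeas|exact: onem_tensors_bmeas].
  - by apply: bmeasM; [exact: tensor_bmeas|exact: onem_tensors_bmeas].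
  apply: eq_Rintegral => x _; rewrite big_cons.
  have -> : tensor gl x = tensor g x * tensor (G l) x by rewrite /tensor -big_split.
  by ring.
rewrite E; under eq_fun do rewrite E.
by apply: cvgB; exact: IH.
Qed.

Lemma open_lower_approximation (U : set (prod_topology S)) (e : R) :
  open U -> 0 < e -> exists h : borel (prod_topology S) -> R,
  [/\ bmeas h, forall x, h x <= \1_U x,
      \int[mu m]_x h x @[m --> \oo] --> \int[nu]_x h x &
      \int[nu]_x \1_U x - e <= \int[nu]_x h x].
Proof.
move=> oU e0; have [G [s [tG out lim]]] := open_approximation oU.
pose h n (x : borel (prod_topology S)) : R := 1 - \prod_(l <- s n) (1 - tensor (G l) x).
have t01 l x : 0 <= 1 - tensor (G l) x <= 1.
  by have [_ /(_ x)] := unit_test_tensor (tG l); lra.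
have p01 n x : 0 <= \prod_(l <- s n) (1 - tensor (G l) x) <= 1.
  by apply/andP; split; [apply: prodr_ge0|apply: prodr_ile1] => l //;
    case/andP: (t01 l x).
have bh n : bmeas (h n).
  by apply: bmeasB; [exact: bmeas_cst|exact: onem_tensors_bmeas].
have : \int[nu]_x h n x @[n --> \oo] --> \int[nu]_x \1_U x.
  apply: (expect_bounded_cvg (B := 1)) => //.
  - by move=> n x; rewrite /h; have := p01 n x; rewrite ler_norml; lra.
  - by apply: bmeas_indic; exact: sub_sigma_algebra.
move=> /cvgrPdist_le/(_ e e0)[n _ /(_ n (leqnn n))] /= nP.
exists (h n); split => //.
- move=> x; rewrite indicE; case: (boolP (x \in U)) => [_|/negP xU].
    by rewrite /h mulr1n; have := p01 n x; lra.
  by rewrite /h out ?subrr// => Ux; apply: xU; exact/mem_set.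
- rewrite expectB ?expect_cst; [|exact: bmeas_cst|exact: onem_tensors_bmeas].
  under eq_fun do (rewrite expectB ?expect_cst;
    [|exact: bmeas_cst|exact: onem_tensors_bmeas]).
  by apply: cvgB; [exact: cvg_cst|exact: cvg_onem_tensors].
- by move: nP; rewrite ler_norml; lra.
Qed.

(** The portmanteau lower bound for open sets, transferred to continuous functions
through their superlevel sets. *)
Lemma expect_lower_semicontinuous (f : prod_topology S -> R) (e : R) :
  unit_test f -> 0 < e ->
  \forall m \near \oo, \int[nu]_x f x - e <= \int[mu m]_x f x.
Proof.
move=> tf e0; have bf := unit_test_bmeas tf; have [cf f01] := tf.
have e30 : 0 < e / 3 by rewrite divr_gt0.
have [p pe] : exists p : nat, p.+1%:R^-1 < e / 3 :> R.
  have := near_infty_natSinv_lt (PosNum e30) => -[b _ /(_ b)] /= h.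
  by exists b; exact: h.
set N : R := p.+1%:R in pe.
have N0 : 0 < N by rewrite ltr0n.
pose U (l : 'I_p.+1) := [set x | l.+1%:R / N < f x].
have oU l : open (U l).
  move/continuousP : cf => /(_ [set y | l.+1%:R / N < y]); apply.
  exact: open_gt.
have /choice[h Hh] : forall l, exists h : borel (prod_topology S) -> R,
    [/\ bmeas h, forall x, h x <= \1_(U l) x,
      \int[mu m]_x h x @[m --> \oo] --> \int[nu]_x h x &
      \int[nu]_x \1_(U l) x - e / 3 <= \int[nu]_x h x].
  by move=> l; exact: open_lower_approximation.
have bh l : bmeas (h l) by have [] := Hh l.
have b1 l : bmeas (\1_(U l) : borel (prod_topology S) -> R).
  by apply: bmeas_indic; exact: sub_sigma_algebra.
have count x : f x - N^-1 <= N^-1 * \sum_l (\1_(U l) x : R) <= f x.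
  have -> : \sum_l (\1_(U l) x : R) = \sum_(l < p.+1) (l.+1%:R < N * f x)%R%:R.
    apply: eq_bigr => l _; rewrite indicE; congr (_%:R); congr nat_of_bool.
    rewrite [N * _]mulrC -ltr_pdivrMr//.
    by apply/idP/idP => [/set_mem|?]; [|exact/mem_set].
  have := @threshold_count R p.+1 (N * f x).
  have /andP[fx0 fx1] := f01 x.
  rewrite mulr_ge0 ?(ltW N0)//= ler_piMr ?(ltW N0)// => /(_ isT)/andP[lo up].
  rewrite ler_pdivrMl// up andbT ler_pdivlMl// mulrBr mulfV// gt_eqF//.
have H : N^-1 * \sum_l \int[mu m]_x h l x @[m --> \oo] -->
    N^-1 * \sum_l \int[nu]_x h l x.
  apply: cvgM; first exact: cvg_cst.
  by apply: (@cvg_big _ _ _ _ _ add_continuous) => l _; have [] := Hh l.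
have low : \int[nu]_x f x - e / 3 - e / 3 <= N^-1 * \sum_l \int[nu]_x h l x.
  apply: (@le_trans _ _ (N^-1 * \sum_l (\int[nu]_x \1_(U l) x - e / 3))); last first.
    by rewrite ler_pM2l ?invr_gt0//; apply: ler_sum => l _; have [] := Hh l.
  rewrite sumrB sumr_const card_ord -[_ *+ p.+1]mulr_natl mulrBr mulKf ?gt_eqF//.
  rewrite -expect_sum// -expectZ; last exact: bmeas_sum.
  rewrite lerD2r (le_trans _ (_ : \int[nu]_x (f x - N^-1) <= _))//.
    rewrite expectB ?expect_cst//; last exact: bmeas_cst.
    by rewrite lerD2l lerN2 ltW.
  apply: le_expect.
  - by apply: bmeasB => //; exact: bmeas_cst.
  - by apply: bmeasM; [exact: bmeas_cst|exact: bmeas_sum].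
  - by move=> x; case/andP: (count x).
move/cvgrPdist_le : H => /(_ _ e30); apply: filterS => m /=.
have up : N^-1 * \sum_l \int[mu m]_x h l x <= \int[mu m]_x f x.
  rewrite -expect_sum// -expectZ; last exact: bmeas_sum.
  apply: le_expect => //.
    by apply: bmeasM; [exact: bmeas_cst|exact: bmeas_sum].
  move=> x; apply: le_trans (_ : N^-1 * \sum_l (\1_(U l) x : R) <= _); last first.
    by case/andP: (count x).
  by rewrite ler_pM2l ?invr_gt0//; apply: ler_sum => l _; have [] := Hh l.
move: low up; set a := N^-1 * _; set b := N^-1 * _; move: a b => a b.
rewrite ler_norml; lra.
Qed.

(** The lower bounds for [f] and for [1 - f] squeeze the integrals when [f] takes
values in [0, 1]; an affine change of scale covers all bounded [f]. *)
Lemma weak_cvg_tensor : weak_cvg mu nu.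
Proof.
have unitc (f : prod_topology S -> R) : unit_test f ->
    \int[mu m]_x f x @[m --> \oo] --> \int[nu]_x f x.
  move=> tf; apply/cvgrPdist_le => e e0.
  have tf' : unit_test (fun x => 1 - f x) by exact: unit_test_onem.
  have bf := unit_test_bmeas tf.
  near=> m.
  have : \int[nu]_x f x - e <= \int[mu m]_x f x.
    by near: m; exact: expect_lower_semicontinuous.
  have : \int[nu]_x (1 - f x) - e <= \int[mu m]_x (1 - f x).
    by near: m; exact: expect_lower_semicontinuous.
  rewrite !expectB ?expect_cst//; try exact: bmeas_cst.
  by rewrite ler_norml; lra.
move=> f cf [B0 [_ fB0]].
pose B := Num.max 1 (B0 + 1).
have B_gt0 : 0 < B by rewrite lt_max ltr01.
have fB x : `|f x| <= B.
  by apply: fB0 => //; rewrite /B lt_max ltrDl ltr01 orbT.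
have bf : bmeas (f : borel (prod_topology S) -> R) by exact: continuous_bmeas fB.
pose g x := (2 * B)^-1 * (f x + B).
have tg : unit_test g by exact: unit_test_rescale.
have E (rho : probability (borel (prod_topology S)) R) :
    \int[rho]_x f x = 2 * B * \int[rho]_x g x - B.
  rewrite -expectZ; last exact: unit_test_bmeas.
  rewrite -[X in _ - X](expect_cst rho) -expectB; last 2 first.
  - by apply: bmeasM; [exact: bmeas_cst|exact: unit_test_bmeas].
  - exact: bmeas_cst.
  apply: eq_Rintegral => x _.
  by rewrite /g mulrA mulfV ?mul1r ?addrK// gt_eqF// mulr_gt0.
rewrite E; under eq_fun do rewrite E.
by apply: cvgB; [apply: cvgM; [exact: cvg_cst|exact: unitc]|exact: cvg_cst].
Unshelve. all: by end_near. Qed.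

End convergence_criterion.

(** * Block averages under a product measure *)

Section marginals.
Context {R : realType} {I J : finType} (S : I -> polishType R).
Variables (P : forall i, probability (borel (S i)) R) (e : J -> I).
Hypothesis e_inj : injective e.

(** A coordinate map [e] sends the product measure to the product of the [P (e j)].
The proof extends [g] to a tensor [G] over all of [I] by constants 1. *)
Lemma expect_marginal (g : forall j, S (e j) -> R) :
  (forall j, unit_test (g j)) ->
  \int[product_probability P]_x (\prod_j g j (x (e j))) =
  \prod_j \int[P (e j)]_y g j y.
Proof.
move=> tg.
have H l : exists h : S l -> R, [/\ unit_test h,
    forall j (E : e j = l), h = ecast l (S l -> R) E (g j) &
    (forall j, e j != l) -> h = fun=> 1].
  have [[j <-]|nj] := pselect (exists j, e j = l).
    exists (g j); split=> [||/(_ j)]; [exact: tg| |by rewrite eqxx].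
    move=> j' E; have jj' := e_inj E; move: E; rewrite jj' => E.
    by rewrite (eq_axiomK E).
  exists (fun=> 1); split=> //.
    by apply: unit_test_cst; rewrite ler01 lexx.
  by move=> j E; exfalso; apply: nj; exists j.
pose G l := projT1 (cid (H l)).
have GP l : [/\ unit_test (G l),
    forall j (E : e j = l), G l = ecast l (S l -> R) E (g j) &
    (forall j, e j != l) -> G l = fun=> 1] := projT2 (cid (H l)).
have tG l : unit_test (G l) by have [] := GP l.
have Ge j : G (e j) = g j by have [_ /(_ j erefl)] := GP (e j).
have G1 l : l \notin e @: J -> G l = fun=> 1.
  move=> lJ; have [_ _] := GP l; apply=> j.
  by apply: contraNneq lJ => <-; exact: imset_f.
have reindexE (F : I -> R) : (forall l, l \notin e @: J -> F l = 1) ->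
    \prod_l F l = \prod_j F (e j).
  move=> F1; rewrite (bigID (mem (e @: J)))/= [X in _ * X]big1 ?mulr1//.
  by rewrite big_imset/=; [apply: eq_bigl|move=> ? ? _ _; exact: e_inj].
have -> : \prod_j \int[P (e j)]_y g j y = \prod_l \int[P l]_y G l y.
  rewrite reindexE; first by apply: eq_bigr => j _; rewrite Ge.
  by move=> l /G1 ->; exact: expect_cst.
rewrite -expect_tensor//; apply: eq_Rintegral => x _.
rewrite /tensor reindexE; first by apply: eq_bigr => j _; rewrite Ge.
by move=> l /G1 ->.
Qed.

End marginals.

Section block_average.
Context {R : realType} (T : polishType R) (P : probability (borel T) R).
Variables (k M : nat) (g : 'I_k -> T -> R).
Hypothesis tg : forall j, unit_test (g j).
Hypothesis M_gt0 : (0 < M)%N.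

Definition block (y : nat -> T) (b : nat) : R := \prod_j g j (y (b * k + j)%N).

Definition block_average (y : nat -> T) : R := M%:R^-1 * \sum_(b < M) block y b.

Lemma block01 y b : 0 <= block y b <= 1.
Proof.
have g01 j : 0 <= g j (y (b * k + j)%N) <= 1 by exact: (tg j).2.
by apply/andP; split; [apply: prodr_ge0|apply: prodr_ile1] => j _;
  case/andP: (g01 j) => // -> ->.
Qed.

Lemma block_average01 y : 0 <= block_average y <= 1.
Proof.
have tb (b : 'I_M) : unit_test (fun _ : T => block y b).
  exact: unit_test_cst (block01 y b).
exact: (unit_test_mean M_gt0 tb).2 point.
Qed.

(** Block averages are defined on sequences, so that they apply both to points of
the product space and to particle systems of any size; the value beyond the last
coordinate is never read by the first [M] blocks. *)
Definition coordn (x : 'I_(M * k) -> T) (n : nat) : T :=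
  if insub n is Some l then x l else point.

Lemma block_index_subproof (b : 'I_M) (j : 'I_k) : (b * k + j < M * k)%N.
Proof.
have jk := ltn_ord j; have bM := ltn_ord b.
by rewrite (@leq_trans (b.+1 * k)%N) ?leq_mul// mulSn addnC ltn_add2r.
Qed.

Definition block_index b j := Ordinal (block_index_subproof b j).

Lemma block_index_inj b b' j j' :
  block_index b j = block_index b' j' -> b = b' /\ j = j'.
Proof.
move=> /(congr1 val)/= E; have jk := ltn_ord j; have jk' := ltn_ord j'.
have k0 : (0 < k)%N := leq_ltn_trans (leq0n j) jk.
have Eb : b = b' :> nat.
  by move: (congr1 (divn^~ k) E); rewrite !divnMDl// !divn_small// !addn0.
split; first exact: val_inj.
by apply: val_inj; move: E; rewrite Eb => /addnI.
Qed.

Lemma block_coordn x (b : 'I_M) : block (coordn x) b = \prod_j g j (x (block_index b j)).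
Proof.
apply: eq_bigr => j _; congr (g j _); rewrite /coordn.
rewrite (insubT (fun l => (l < M * k)%N) (block_index_subproof b j)).
by congr x; exact: val_inj.
Qed.

Let c := \prod_j \int[P]_y g j y.
Let Q := product_probability (fun _ : 'I_(M * k) => P).

Lemma expect_block b : \int[Q]_x (\prod_j g j (x (block_index b j))) = c.
Proof.
rewrite (@expect_marginal R _ _ (fun=> T) (fun=> P) (block_index b))//.
by move=> j j' /block_index_inj[].
Qed.

(** Distinct blocks involve disjoint coordinates: together they form the marginal
indexed by two copies of ['I_k]. *)
Lemma expect_blockM b b' : b != b' ->
  \int[Q]_x ((\prod_j g j (x (block_index b j))) *
             (\prod_j g j (x (block_index b' j)))) = c ^+ 2.
Proof.
move=> bb'.
pose e (z : 'I_k + 'I_k) := match z with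
  | inl j => block_index b j | inr j => block_index b' j end.
pose gg (z : 'I_k + 'I_k) := match z with inl j => g j | inr j => g j end.
have e_inj : injective e.
  by move=> [j|j] [j'|j'] /= /block_index_inj [E E'];
    rewrite ?E' //; move: bb'; rewrite E eqxx.
have tgg z : unit_test (gg z) by case: z => j; exact: tg.
have := expect_marginal (fun=> P) e_inj tgg.
rewrite big_sumType/= -expr2 => <-.
by apply: eq_Rintegral => x _; rewrite big_sumType.
Qed.

Lemma unit_test_block b : unit_test
  (fun x : prod_topology (fun _ : 'I_(M * k) => T) => \prod_j g j (x (block_index b j))).
Proof.
apply: unit_test_prod => j _.
exact: (unit_test_coord (S := fun _ : 'I_(M * k) => T)).
Qed.

Lemma prod_expect01 : 0 <= c <= 1.
Proof.
have g01 j : 0 <= \int[P]_y g j y <= 1.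
  exact: (expect_unit P (unit_test_bmeas (tg j)) (tg j).2).
by apply/andP; split; [apply: prodr_ge0|apply: prodr_ile1] => j _;
  case/andP: (g01 j) => // -> ->.
Qed.

Lemma unit_test_deviation : unit_test
  (fun x : prod_topology (fun _ : 'I_(M * k) => T) => (block_average (coordn x) - c) ^+ 2).
Proof.
rewrite (_ : (fun _ => _) = fun x : prod_topology (fun _ : 'I_(M * k) => T) =>
    (M%:R^-1 * (\sum_b \prod_j g j (x (block_index b j))) - c) ^+ 2).
  apply: unit_test_sqr_dist; first exact: prod_expect01.
  by apply: unit_test_mean => // b; exact: unit_test_block.
apply/funext => x; congr ((_ * _ - _) ^+ _).
by apply: eq_bigr => b _; rewrite block_coordn.
Qed.

(** The variance of a mean of [M] pairwise uncorrelated variables: in the double sum,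
only the [M] diagonal terms survive and each is at most 1. *)
Lemma variance_block_average :
  \int[Q]_x ((block_average (coordn x) - c) ^+ 2) <= M%:R^-1.
Proof.
have M0 : 0 < M%:R :> R by rewrite ltr0n.
pose a b (x : borel (prod_topology (fun _ : 'I_(M * k) => T))) :=
  \prod_j g j (x (block_index b j)).
have ba b : bmeas (a b) by apply: unit_test_bmeas; exact: unit_test_block.
have a01 b x : 0 <= a b x <= 1 by exact: (unit_test_block b).2.
have c01 := prod_expect01.
have bac b : bmeas (fun x => a b x - c) by apply: bmeasB => //; exact: bmeas_cst.
have baa b b' : bmeas (fun x => (a b x - c) * (a b' x - c)) by exact: bmeasM.
have E x : (block_average (coordn x) - c) ^+ 2 =
    M%:R^-2 * \sum_b \sum_b' (a b x - c) * (a b' x - c).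
  have -> : block_average (coordn x) - c = M%:R^-1 * \sum_b (a b x - c).
    rewrite sumrB sumr_const card_ord -[c *+ M]mulr_natl mulrBr mulKf ?gt_eqF//.
    by congr (_ * _ - _); apply: eq_bigr => b _; rewrite block_coordn.
  rewrite exprMn exprVn; congr (_ * _); rewrite expr2 mulr_suml.
  by apply: eq_bigr => b _; rewrite mulr_sumr.
under eq_Rintegral do rewrite E.
rewrite expectZ; last by apply: bmeas_sum => b; exact: bmeas_sum.
rewrite expect_sum; last by move=> b; exact: bmeas_sum.
have H b : \int[Q]_x (\sum_b' (a b x - c) * (a b' x - c)) <= 1.
  rewrite expect_sum// (bigD1 b)//= [X in _ + X]big1 ?addr0; last first.
    move=> b' bb'.
    have -> : \int[Q]_x ((a b x - c) * (a b' x - c)) =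
        \int[Q]_x (a b x * a b' x) - \int[Q]_x (c * (a b x - c))
        - \int[Q]_x (c * a b' x).
      rewrite -!expectB//; last 4 first.
      - by apply: bmeasB; [exact: bmeasM|apply: bmeasM => //; exact: bmeas_cst].
      - by apply: bmeasM => //; exact: bmeas_cst.
      - by apply: bmeasM.
      - by apply: bmeasM => //; exact: bmeas_cst.
      by apply: eq_Rintegral => x _; ring.
    rewrite !expectZ// expectB//; last exact: bmeas_cst.
    rewrite expect_cst !expect_block expect_blockM 1?eq_sym//.
    by ring.
  rewrite -[leRHS](expect_cst Q); apply: le_expect => //; first exact: bmeas_cst.
  by move=> x; have [_ /(_ x)/andP[_]] := unit_test_sqr_dist c01 (unit_test_block b).
rewrite -exprVn expr2 -mulrA -[leRHS]mulr1 ler_pM2l ?invr_gt0//.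
rewrite ler_pdivrMl// mulr1 -[leRHS]mulr1n.
apply: le_trans (_ : \sum_(b < M) (1 : R) <= _); first exact: ler_sum.
by rewrite sumr_const card_ord.
Qed.

End block_average.

(** * Block averages of a multi-exchangeable system *)

(** The permutation exchanges the blocks [0] and [b] of length [k]; they are disjoint
unless [b = 0], when it is the identity. *)
Lemma block_swap (k b n : nat) : (b.+1 * k <= n)%N ->
  exists s : 'S_n, forall i : 'I_n, (i < k)%N -> s i = (b * k + i)%N :> nat.
Proof.
rewrite mulSn => bn.
have cE : (b * k = 0 \/ k <= b * k)%N.
  by case: b bn => [|b] _; [left|right; rewrite mulSn leq_addr].
set c := (b * k)%N in cE bn *.
pose f m := if (m < k)%N then (c + m)%N
  else if (c <= m < c + k)%N then (m - c)%N else m.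
have fn (i : 'I_n) : (f i < n)%N.
  by have := ltn_ord i; rewrite /f; case: cE => ?; repeat (case: ifP => ?); lia.
have f_inj : injective (fun i : 'I_n => Ordinal (fn i)).
  move=> i j /(congr1 val)/= E; apply: val_inj => /=; move: E; rewrite /f.
  by case: cE => ?; repeat (case: ifP => ?); lia.
exists (perm f_inj) => i ik; by rewrite permE /= /f ik.
Qed.

Lemma particleE (R : realType) (T : ptopologicalType) d
    (Om : measurableType d) (Pr : probability Om R) (n : nat)
    (X : 'I_n -> {RV Pr >-> borel T}) (l : nat) (i : 'I_n) :
  i = l :> nat -> particle X l = X i.
Proof.
move=> il; rewrite /particle; have ln : (l < n)%N by rewrite -il.
by rewrite (insubT (fun l => (l < n)%N) ln); congr X; exact: val_inj.
Qed.

Section one_system.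
Context {R : realType} {C : nat} (S : 'I_C -> polishType R) d
  (Om : measurableType d) (Pr : probability Om R) (N : 'I_C -> nat)
  (X : forall i, 'I_(N i) -> {RV Pr >-> borel (S i)}).
Variables (k : nat) (g : forall i, 'I_k -> S i -> R).
Arguments X : clear implicits.
Arguments g : clear implicits.
Hypothesis tg : forall i j, unit_test (g i j).

Let Y i w l : S i := particle (X i) l w.

Lemma block_bmeas i b : bmeas (fun w => block (g i) (Y i w) b).
Proof.
rewrite /block; apply: bmeas_prod => j.
apply: (bmeas_comp (f := g i j : borel (S i) -> R)); first exact: measurable_funP.
by apply: unit_test_bmeas; exact: tg.
Qed.

Lemma block_average_bmeas M i : bmeas (fun w => block_average M (g i) (Y i w)).
Proof.
rewrite /block_average; apply: bmeasM; first exact: bmeas_cst.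
by apply: bmeas_sum => b; exact: block_bmeas.
Qed.

Hypothesis X_exch : multi_exchangeable X.

(** Swapping block [0] with block [b i] inside class [i] uses the full strength of
multi-exchangeability: the permutations of the classes are unrelated. *)
Lemma expect_blocks (b : 'I_C -> nat) : (forall i, ((b i).+1 * k <= N i)%N) ->
  \int[Pr]_w (\prod_i block (g i) (Y i w) (b i)) =
  \int[Pr]_w (\prod_i block (g i) (Y i w) 0).
Proof.
move=> bN.
have kN i (j : 'I_k) : (j < N i)%N.
  by apply: leq_trans (ltn_ord j) (leq_trans _ (bN i)); rewrite mulSn leq_addr.
pose sigma i := projT1 (cid (block_swap (bN i))).
have sigmaE i (l : 'I_(N i)) : (l < k)%N -> sigma i l = (b i * k + l)%N :> nat.
  exact: (projT2 (cid (block_swap (bN i)))).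
pose I := {i : 'I_C & 'I_(N i)}.
pose SS (a : I) := S (tag a).
pose first i j : I := Tagged (fun i => 'I_(N i)) (Ordinal (kN i j)).
pose F (x : prod_topology SS) : R := \prod_i \prod_j g i j (x (first i j)).
have bF : bmeas (F : borel (prod_topology SS) -> R).
  apply: unit_test_bmeas; apply: unit_test_prod => i _.
  apply: unit_test_prod => j _.
  by apply: (@unit_test_coord R I SS (first i j) (g i j)); exact: tg.
have : \int[joint_law (fun a : I => X (tag a) (sigma (tag a) (tagged a)))]_x F x =
    \int[joint_law (fun a : I => X (tag a) (tagged a))]_x F x.
  rewrite /Rintegral; congr fine.
  by apply: eq_measure_integral => A mA _; exact: (X_exch sigma mA).
rewrite !expect_distribution// => E; apply: etrans (etrans E _).
- apply: eq_Rintegral => w _; apply: eq_bigr => i _; apply: eq_bigr => j _.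
  by rewrite /Y (particleE (X i) (sigmaE i (Ordinal (kN i j)) (ltn_ord j))).
- apply: eq_Rintegral => w _; apply: eq_bigr => i _; apply: eq_bigr => j _.
  by rewrite /Y (@particleE _ _ _ _ _ _ (X i) (0 * k + j) (Ordinal (kN i j))).
Qed.

(** Expanding the product of the averages gives one term for each choice of a block
in every class, and all terms have the same expectation. *)
Lemma expect_block_averages (M : nat) : (0 < M)%N ->
  (forall i, (M * k <= N i)%N) ->
  \int[Pr]_w (\prod_i block_average M (g i) (Y i w)) =
  \int[Pr]_w (\prod_i block (g i) (Y i w) 0).
Proof.
move=> M_gt0 MN.
have bP (f : 'I_C -> 'I_M) : bmeas (fun w => \prod_i block (g i) (Y i w) (f i)).
  by apply: bmeas_prod => i; exact: block_bmeas.
under eq_Rintegral do rewrite big_split/= bigA_distr_bigA prodr_const card_ord/=.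
rewrite expectZ; last by apply: bmeas_sum => f.
rewrite expect_sum//.
under eq_bigr => f _.
  rewrite expect_blocks; last first.
    by move=> i; apply: leq_trans (MN i); rewrite leq_mul2r ltn_ord orbT.
  over.
rewrite sumr_const card_ffun !card_ord -[X in _ * X]mulr_natl natrX exprVn.
by rewrite mulKf// expf_neq0// pnatr_eq0 -lt0n.
Qed.

End one_system.

(** * From class-wise chaos to multi-class chaos *)

Lemma prod_dist_le (R : realType) (I : Type) (s : seq I) (a c : I -> R) :
  (forall i, 0 <= a i <= 1) -> (forall i, 0 <= c i <= 1) ->
  `|\prod_(i <- s) a i - \prod_(i <- s) c i| <= \sum_(i <- s) `|a i - c i|.
Proof.
move=> a01 c01; elim: s => [|i s IH]; first by rewrite !big_nil subrr normr0.
rewrite !big_cons.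
set p := \prod_(j <- s) a j; set q := \prod_(j <- s) c j.
have -> : a i * p - c i * q = (a i - c i) * p + c i * (p - q) by ring.
apply: le_trans (ler_normD _ _) _; rewrite !normrM; apply: lerD.
  rewrite ler_piMr// normr_prod; apply: prodr_ile1 => j _.
  by rewrite normr_ge0/= ger0_norm; case/andP: (a01 j).
apply: le_trans IH; rewrite ler_piMl//.
by rewrite ger0_norm; case/andP: (c01 i).
Qed.

(** Bounds a first moment by a second moment without square roots. *)
Lemma norm_le_sqr (R : realType) (delta v : R) : 0 < delta ->
  `|v| <= delta + delta^-1 * v ^+ 2.
Proof.
move=> d0; rewrite -(ler_pM2l d0) mulrDr mulVKf ?gt_eqF//.
rewrite -real_normK ?num_real//.
by have := sqr_ge0 (`|v| - delta); have := normr_ge0 v; nra.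
Qed.

Lemma weak_cvg_unit_test (R : realType) (T : ptopologicalType)
    (mu : nat -> probability (borel T) R) (nu : probability (borel T) R)
    (f : T -> R) : weak_cvg mu nu -> unit_test f ->
  \int[mu m]_x f x @[m --> \oo] --> \int[nu]_x f x.
Proof.
move=> munu [cf f01]; apply: munu => //.
exists 1; split; first by rewrite num_real.
move=> r r1 x _ /=; have /andP[? fx1] := f01 x.
by rewrite ger0_norm// (le_trans fx1)// ltW.
Qed.

(** The squared deviation is a continuous bounded function of the first [M * k]
particles, so chaoticity carries the variance bound over to the limit. *)
Lemma chaotic_block_average (R : realType) (T : polishType R)
    (d : nat -> measure_display) (Om : forall m, measurableType (d m))
    (Pr : forall m, probability (Om m) R) (n : nat -> nat)
    (X : forall m, 'I_(n m) -> {RV (Pr m) >-> borel T})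
    (P : probability (borel T) R) (k M : nat) (g : 'I_k -> T -> R) (e : R) :
  chaotic X P -> (0 < k)%N -> (0 < M)%N -> (forall j, unit_test (g j)) -> 0 < e ->
  \forall m \near \oo,
    \int[Pr m]_w ((block_average M g (fun l => particle (@X m) l w)
      - \prod_j \int[P]_y g j y) ^+ 2) <= M%:R^-1 + e.
Proof.
move=> chX k0 M0 tg e0.
have Mk0 : (0 < M * k)%N by rewrite muln_gt0 M0.
have := weak_cvg_unit_test (chX _ Mk0) (unit_test_deviation P tg M0).
move/cvgrPdist_le => /(_ e e0); apply: filterS => m /=.
rewrite expect_distribution; last first.
  by apply: unit_test_bmeas; exact: unit_test_deviation.
have := variance_block_average P tg M0.
set a := \int[_]_x _; set b := \int[_]_x _; set b' := \int[_]_x _.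
have -> : b' = b.
  apply: eq_Rintegral => w _; congr ((_ * _ - _) ^+ _).
  by apply: eq_bigr => l _; rewrite block_coordn.
by rewrite ler_norml; lra.
Qed.

Theorem theorem3p3 (R : realType) (C : nat) (C_ge1 : (1 <= C)%N)
    (S : 'I_C -> polishType R)
    (d : ('I_C -> nat) -> measure_display)
    (Om : forall N, measurableType (d N))
    (Pr : forall N, probability (Om N) R)
    (X : forall (N : 'I_C -> nat) (i : 'I_C),
      'I_(N i) -> {RV (Pr N) >-> borel (S i)})
    (X_exch : forall N : 'I_C -> nat, (forall i, (1 <= N i)%N) ->
      multi_exchangeable (X N))
    (P : forall i, probability (borel (S i)) R)
    (Ns : nat -> 'I_C -> nat)
    (Ns_ge1 : forall m i, (1 <= Ns m i)%N)
    (Ns_infty : forall K : nat, \forall m \near \oo, forall i, (K <= Ns m i)%N) :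
  multi_chaotic (fun m => X (Ns m)) P <->
  forall i : 'I_C, chaotic (fun m => X (Ns m) i) (P i).
Proof.
split=> [chX i k k0|chX k k0]; apply: weak_cvg_tensor => g tg.
  pose S' (p : 'I_C * 'I_k) := S p.1.
  pose f (x : prod_topology S') := \prod_j g j (x (i, j)).
  have tf : unit_test f.
    apply: unit_test_prod => j _.
    by apply: (@unit_test_coord R _ S' (i, j) (g j)); exact: tg.
  rewrite expect_tensor//.
  have e_inj : injective (fun j : 'I_k => (i, j)) by move=> j j' [].
  have := @expect_marginal R _ _ S' (fun p => P p.1) _ e_inj g tg => /= <-.
  have := weak_cvg_unit_test (chX k k0) tf; apply: cvg_trans.
  apply: near_eq_cvg; apply: nearW => m.
  rewrite (expect_distribution _ (unit_test_bmeas tf)).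
  by rewrite (expect_distribution _ (tensor_bmeas tg)).
pose G (i : 'I_C) : 'I_k -> S i -> R := fun j => g (i, j).
have tG i j : unit_test (G i j) := tg (i, j).
pose c i := \prod_j \int[P i]_y G i j y.
have c01 i : 0 <= c i <= 1 := prod_expect01 (P i) (tG i).
rewrite expect_tensor//.
have -> : \prod_p \int[P p.1]_y g p y = \prod_i c i.
  by rewrite /c pair_bigA; apply: eq_bigr => -[].
apply/cvgrPdist_le => e e0.
have C0 : 0 < C%:R :> R by rewrite ltr0n.
(* Each class contributes [delta + delta^-1 * (2 * delta ^+ 2)], that is
   [3 * delta], to the error; the total over [C] classes is [e]. *)
pose delta := e / (3 * C%:R).
have d0 : 0 < delta by rewrite divr_gt0// mulr_gt0.
have [M M0 Md] : exists2 M, (0 < M)%N & M%:R^-1 <= delta ^+ 2.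
  have dd0 : 0 < delta ^+ 2 by rewrite exprn_gt0.
  have := near_infty_natSinv_lt (PosNum dd0) => -[b _ /(_ b)] /= h.
  by exists b.+1 => //; apply/ltW/h.
have dd0 : 0 < delta ^+ 2 by rewrite exprn_gt0.
have dev : \forall m \near \oo, forall i,
    \int[Pr (Ns m)]_w ((block_average M (G i) (fun l => particle (X (Ns m) i) l w)
      - c i) ^+ 2) <= M%:R^-1 + delta ^+ 2.
  by apply: filter_forall => i; exact: chaotic_block_average.
have large := Ns_infty (M * k)%N.
near=> m.
have devm : forall i,
    \int[Pr (Ns m)]_w ((block_average M (G i) (fun l => particle (X (Ns m) i) l w)
      - c i) ^+ 2) <= M%:R^-1 + delta ^+ 2.
  by near: m.
have exch := X_exch (Ns m) (Ns_ge1 m).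
have -> : \int[joint_law (fun p : 'I_C * 'I_k => particle (X (Ns m) p.1) p.2)]_x tensor g x =
    \int[Pr (Ns m)]_w (\prod_i block_average M (G i)
      (fun l => particle (X (Ns m) i) l w)).
  rewrite (@expect_block_averages _ _ _ _ _ _ _ _ _ _ tG exch)//; last by near: m.
  rewrite expect_distribution; last exact: tensor_bmeas.
  by apply: eq_Rintegral => w _; rewrite /tensor /block pair_bigA; apply: eq_bigr => -[].
set V := fun i w => block_average M (G i) (fun l => particle (X (Ns m) i) l w).
have bV i : bmeas (V i) by exact: block_average_bmeas.
have V01 i w : 0 <= V i w <= 1 by exact: block_average01.
have bdev i : bmeas (fun w => (V i w - c i) ^+ 2).
  by apply: bmeasM; apply: bmeasB => //; exact: bmeas_cst.
have bound w : `|\prod_i c i - \prod_i V i w| <=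
    \sum_i (delta + delta^-1 * (V i w - c i) ^+ 2).
  rewrite distrC; apply: le_trans (prod_dist_le _ _ _) _ => //.
  by apply: ler_sum => i _; exact: norm_le_sqr.
have bsum : bmeas (fun w => \sum_i (delta + delta^-1 * (V i w - c i) ^+ 2)).
  apply: bmeas_sum => i; apply: bmeasD; first exact: bmeas_cst.
  by apply: bmeasM => //; exact: bmeas_cst.
have bprod : bmeas (fun w => \prod_i V i w) by exact: bmeas_prod.
have total : \int[Pr (Ns m)]_w (\sum_i (delta + delta^-1 * (V i w - c i) ^+ 2)) <= e.
  rewrite expect_sum; last first.
    move=> i; apply: bmeasD; first exact: bmeas_cst.
    by apply: bmeasM => //; exact: bmeas_cst.
  apply: le_trans (_ : \sum_(i < C) (3 * delta) <= _); last first.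
    rewrite sumr_const card_ord -mulr_natl /delta.
    by rewrite le_eqVlt; apply/orP; left; apply/eqP; field; rewrite gt_eqF.
  apply: ler_sum => i _; rewrite expectD; [|exact: bmeas_cst|]; last first.
    by apply: bmeasM => //; exact: bmeas_cst.
  rewrite expect_cst expectZ// [leRHS](_ : _ = delta + 2 * delta); last by ring.
  rewrite lerD2l ler_pdivrMl//.
  apply: le_trans (devm i) _; rewrite mulrCA -expr2; lra.
rewrite -[X in X - _](expect_cst (Pr (Ns m))) -expectB//; last exact: bmeas_cst.
have bdiff : bmeas (fun w => \prod_i c i - \prod_i V i w).
  by apply: bmeasB => //; exact: bmeas_cst.
apply: le_trans (le_normr_Rintegral measurableT (bmeas_integrable _ bdiff)) _.
apply: le_trans total; apply: le_expect => //.
by split; [apply: measurableT_comp => //; exact: bdiff.1|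
  have [_ [B HB]] := bdiff; exists B => w; rewrite normr_id].
Unshelve. all: by end_near. Qed.
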